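(* The bijections $\psi:\mathrm{revSSYT}\to\mathrm{qKT}^{(1)}$ and $\Gamma:\mathrm{revSSYT}\to\mathcal{A}\mathrm{SSF}$ restrict to bijections $\mathrm{QrevSSYT}\to\mathrm{QqKT}^{(1)}$ and $\mathrm{QrevSSYT}\to\mathrm{QSSF}$ respectively.
   Context: $\mathrm{revSSYT}$: reverse semistandard Young tableaux of all partition shapes (English notation; positive integer entries; rows weakly decrease left to right, columns strictly decrease top to bottom). For a weak composition $a$, $D(a)$ has $a_i$ left-justified boxes in row $i$, row 1 lowest. Quasi-key tableau of shape $a$: filling of $D(a)$ with positive integers such that (1) rows weakly decrease and no entry of row $i$ exceeds $i$; (2) column entries distinct, increasing going up the first column; (3) if $i$ is above $k$ in a column with $i<k$, there is an entry $j>i$ immediately right of $k$; (4) for two rows with the higher strictly longer, an entry $i$ in column $c$ of the lower and $j$ in column $c+1$ of the higher satisfy $i<j$. $\mathrm{qKT}^{(1)}$: all quasi-key tableaux (all shapes) with first-column entries equal to row indices. Triples of $D(a)$ (rows $r<s$): Type A: $\gamma=(r,c),\alpha=(r,c+1),\beta=(s,c+1)$, $a_r\ge a_s$; Type B: $\gamma=(s,c),\alpha=(s,c+1),\beta=(r,c)$, $a_s>a_r$; inversion triple: $\beta>\gamma\ge\alpha$ or $\gamma\ge\alpha>\beta$. $\mathcal{A}\mathrm{SSF}$: all fillings of skyline diagrams $D(a)$ (all $a$) with positive integers, rows weakly decreasing, distinct column entries, all triples inversion triples, first-column entry of each nonempty row $i$ equal to $i$. $\psi$ (right row-filling): with column sets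 $C_1,C_2,\ldots$ of $V$, repeatedly let $k$ be the largest index with $C_k\neq\emptyset$, choose the smallest $y_k\in C_k$, then for $c=k-1,\ldots,1$ the smallest $y_c\in C_c$ with $y_c\ge y_{c+1}$; make $(y_1,\ldots,y_k)$ row $y_1$ of the output and delete these elements; it is known to be a bijection onto $\mathrm{qKT}^{(1)}$. $\Gamma$ (column-filling): column 1 of $\Gamma(V)$ places each entry $i$ of column 1 of $V$ in row $i$; given column $c$, the entries of column $c+1$ of $V$ are placed in decreasing order, each in the lowest row that has an entry in column $c$ weakly larger than it and an unfilled position in column $c+1$; it is known to be a bijection $\mathrm{revSSYT}\to\mathcal{A}\mathrm{SSF}$. A filling $X$ (in any of these three sets) is quasi-Yamanouchi if for every entry value $i$ of $X$, the leftmost occurrence of $i$ is in the first column of $X$ or lies in a column weakly left of some occurrence of $i+1$. $\mathrm{QrevSSYT}$, $\mathrm{QqKT}^{(1)}$, $\mathrm{QSSF}$ denote the quasi-Yamanouchi elements of $\mathrm{revSSYT}$, $\mathrm{qKT}^{(1)}$, $\mathcal{A}\mathrm{SSF}$. *)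

(* Defs.v *)
From mathcomp Require Import all_boot.
Set Implicit Arguments. Unset Strict Implicit. Unset Printing Implicit Defensive.

(* A filling is a list of rows; row i (1-indexed) is [nth [::] X i.-1] and
   columns are 0-indexed inside a row.  For reverse SSYT, row 1 is the TOP row
   (English notation); for skyline / quasi-key fillings of D(a), row 1 is the
   LOWEST row and the row lengths give the weak composition a. *)
Definition filling := seq (seq nat).

Definition row (X : filling) (r : nat) : seq nat := nth [::] X r.
Definition cell (X : filling) (r c : nat) : Prop := c < size (row X r).
Definition entry (X : filling) (r c : nat) : nat := nth 0 (row X r) c.

(* Canonical representative of a shape: no trailing empty rows. *)
Definition wf_sky (X : filling) : Prop := X = [::] \/ last [::] X <> [::].

Definition positive_entries (X : filling) : Prop :=
  forall r c, cell X r c -> 0 < entry X r c.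
Definition rows_weakly_decr (X : filling) : Prop :=
  forall r c, cell X r c.+1 -> entry X r c.+1 <= entry X r c.
Definition col_distinct (X : filling) : Prop :=
  forall r1 r2 c, cell X r1 c -> cell X r2 c -> entry X r1 c = entry X r2 c -> r1 = r2.

Definition revSSYT (T : filling) : Prop :=
  (forall r, r < size T -> 0 < size (row T r)) /\
  (forall r, r.+1 < size T -> size (row T r.+1) <= size (row T r)) /\
  positive_entries T /\ rows_weakly_decr T /\
  (forall r c, cell T r.+1 c -> entry T r.+1 c < entry T r c).

Definition qKT (X : filling) : Prop :=
  wf_sky X /\
  (forall r c, cell X r c -> 0 < entry X r c <= r.+1) /\ rows_weakly_decr X /\
  col_distinct X /\
  (forall r s, r < s -> cell X r 0 -> cell X s 0 -> entry X r 0 < entry X s 0) /\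
  (forall r s c, r < s -> cell X r c -> cell X s c -> entry X s c < entry X r c ->
     cell X r c.+1 /\ entry X s c < entry X r c.+1) /\
  (forall r s c, r < s -> size (row X r) < size (row X s) ->
     cell X r c -> cell X s c.+1 -> entry X r c < entry X s c.+1).

Definition qKT1 (X : filling) : Prop :=
  qKT X /\ forall r, cell X r 0 -> entry X r 0 = r.+1.

Definition inversion_triple (beta gamma alpha : nat) : Prop :=
  (gamma < beta /\ alpha <= gamma) \/ (alpha <= gamma /\ beta < alpha).

Definition ASSF (X : filling) : Prop :=
  wf_sky X /\ positive_entries X /\ rows_weakly_decr X /\ col_distinct X /\
  (forall r s c, r < s -> size (row X s) <= size (row X r) ->
     cell X r c -> cell X r c.+1 -> cell X s c.+1 ->
     inversion_triple (entry X s c.+1) (entry X r c) (entry X r c.+1)) /\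
  (forall r s c, r < s -> size (row X r) < size (row X s) ->
     cell X s c -> cell X s c.+1 -> cell X r c ->
     inversion_triple (entry X r c) (entry X s c) (entry X s c.+1)) /\
  (forall r, cell X r 0 -> entry X r 0 = r.+1).

Definition quasiYam (X : filling) : Prop :=
  forall r c, cell X r c ->
    (forall r' c', c' < c -> cell X r' c' -> entry X r' c' <> entry X r c) ->
    c = 0 \/ exists r' c', c <= c' /\ cell X r' c' /\ entry X r' c' = (entry X r c).+1.

Definition QrevSSYT (T : filling) : Prop := revSSYT T /\ quasiYam T.
Definition QqKT1 (X : filling) : Prop := qKT1 X /\ quasiYam X.
Definition QSSF (X : filling) : Prop := ASSF X /\ quasiYam X.

Definition ncols (V : filling) : nat := foldr maxn 0 (map size V).
Definition column (V : filling) (c : nat) : seq nat :=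
  [seq nth 0 rw c | rw <- V & c < size rw].
Definition cols (V : filling) : seq (seq nat) := mkseq (column V) (ncols V).

Fixpoint drop_empty (s : seq (seq nat)) : seq (seq nat) :=
  if s is C :: s' then (if C == [::] then drop_empty s' else s) else [::].
Definition trim (cs : seq (seq nat)) := rev (drop_empty (rev cs)).

(* smallest element of C that is >= b (0 if none; never happens on revSSYT) *)
Definition least_geq (b : nat) (C : seq nat) : nat :=
  head 0 (sort leq [seq x <- C | b <= x]).

(* given [C_k; ...; C_1], returns [y_k; ...; y_1] *)
Fixpoint chain (b : nat) (rc : seq (seq nat)) : seq nat :=
  if rc is C :: rc' then let y := least_geq b C in y :: chain y rc' else [::].

Fixpoint psi_rows (fuel : nat) (cs : seq (seq nat)) : seq (seq nat) :=
  if fuel is n.+1 then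
    let cs' := trim cs in
    if cs' is [::] then [::] else
    let ys := rev (chain 0 (rev cs')) in
    ys :: psi_rows n [seq rem p.1 p.2 | p <- zip ys cs']
  else [::].

Definition psi (V : filling) : filling :=
  let R := psi_rows (size (flatten V)) (cols V) in
  let m := foldr maxn 0 (map (head 0) R) in
  mkseq (fun i => head [::] [seq rw <- R | head 0 rw == i.+1]) m.

(* place x in column c (0-indexed, c >= 1) of the lowest row whose column c-1
   entry is >= x and whose column c is still unfilled *)
Definition place (c x : nat) (X : filling) : filling :=
  let i := find (fun rw => (size rw == c) && (x <= nth 0 rw c.-1)) X in
  if i < size X then set_nth [::] X i (rcons (nth [::] X i) x) else X.

Definition fill_col (cs : seq (seq nat)) (X : filling) (c : nat) : filling :=
  foldl (fun Y x => place c x Y) X (sort (fun a b => b <= a) (nth [::] cs c)).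

Definition Gamma (V : filling) : filling :=
  let cs := cols V in
  let C1 := nth [::] cs 0 in
  let X0 := mkseq (fun i => if i.+1 \in C1 then [:: i.+1] else [::]) (foldr maxn 0 C1) in
  foldl (fill_col cs) X0 (iota 1 (size cs).-1).

Definition bij_between (A B : filling -> Prop) (f : filling -> filling) : Prop :=
  (forall x, A x -> B (f x)) /\
  (forall x y, A x -> A y -> f x = f y -> x = y) /\
  (forall z, B z -> exists x, A x /\ f x = z).

(* Main.v *)
Require Import Defs.
From mathcomp Require Import all_boot.
From mathcomp Require Import zify.
Set Implicit Arguments. Unset Strict Implicit. Unset Printing Implicit Defensive.

(* Being quasi-Yamanouchi depends only on the sets of entries of the columns, and
   ψ and Γ preserve these sets.  So it suffices that each of revSSYT, qKT1 and
   ASSF contains at most one filling with given column sets, that ψ and Γ land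
   in qKT1 and ASSF, and that sorting the columns of a filling in qKT1 or ASSF
   gives a reverse tableau.  For ASSF, the triple conditions are equivalent to a
   greedy rule determining each column from the one on its left.  For qKT1,
   listing the rows by decreasing length (lower rows first in case of a tie), the
   conditions amount to each row taking, from right to left, the least entry of
   the column not used by earlier rows that keeps the row weakly decreasing. *)

(** * Entries and columns of fillings *)

Lemma entry_gt0 X r c :
  positive_entries X -> (0 < entry X r c) = (c < size (row X r)).
Proof.
move=> pX; case: (ltnP c (size (row X r))) => [/pX -> //|le_c].
by rewrite /entry nth_default.
Qed.

Lemma row_default X r : size X <= r -> row X r = [::].
Proof. exact: nth_default. Qed.

Lemma cell_size X r c : cell X r c -> r < size X.
Proof.
by rewrite /cell; case: (ltnP r (size X)) => // /row_default ->.
Qed.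

Lemma cell_le X r c c' : c' <= c -> cell X r c -> cell X r c'.
Proof. exact: leq_ltn_trans. Qed.

(** Past the end of the row the entry reads as 0, so the inequality persists there. *)
Lemma entry_wd X r c : rows_weakly_decr X -> entry X r c.+1 <= entry X r c.
Proof.
move=> wX; case: (ltnP c.+1 (size (row X r))) => [/wX //|le_c].
by rewrite {1}/entry nth_default.
Qed.

Lemma entry_le X r c c' :
  rows_weakly_decr X -> c' <= c -> entry X r c <= entry X r c'.
Proof.
move=> wX; elim: c => [|c IH]; first by case: c'.
rewrite leq_eqVlt => /predU1P [-> //|/IH]; apply: leq_trans; exact: entry_wd.
Qed.

Lemma columnE X c :
  column X c = [seq entry X r c | r <- iota 0 (size X) & c < size (row X r)].
Proof.
by rewrite /column -{1}(mkseq_nth [::] X) /mkseq filter_map -map_comp.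
Qed.

Lemma columnP X c x :
  reflect (exists2 r, cell X r c & entry X r c = x) (x \in column X c).
Proof.
rewrite columnE; apply: (iffP mapP) => [[r]|[r cr <-]].
  by rewrite mem_filter => /andP [cr _] ->; exists r.
exists r => //; rewrite mem_filter mem_iota /= add0n (cell_size cr) andbT.
exact: cr.
Qed.

Lemma column_uniq X c : col_distinct X -> uniq (column X c).
Proof.
move=> dX; rewrite columnE map_inj_in_uniq ?filter_uniq ?iota_uniq //.
by move=> r s; rewrite !mem_filter => /andP [cr _] /andP [cs _]; apply: dX.
Qed.

(** Each row counted in column [c.+1] is also counted in column [c], its entry there being at least
    as large. *)
Lemma count_column X c x : rows_weakly_decr X ->
  count (leq x) (column X c.+1) <= count (leq x) (column X c).
Proof.
move=> wX; rewrite !columnE !count_map !count_filter; apply: sub_count => r /=.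
case/andP=> le_x lt_c; rewrite (leq_trans le_x (wX _ _ lt_c)).
exact: ltnW.
Qed.

Lemma leq_foldr_maxn x s : x \in s -> x <= foldr maxn 0 s.
Proof.
elim: s => //= y s IH; rewrite inE leq_max => /predU1P [->|/IH ->].
  by rewrite leqnn.
by rewrite orbT.
Qed.

Lemma foldr_maxn_mem s : 0 < foldr maxn 0 s -> foldr maxn 0 s \in s.
Proof.
elim: s => //= y s IH; rewrite /maxn; case: (ltnP y) => [lt_y _|_ _].
  by rewrite in_cons IH ?orbT // (leq_ltn_trans _ lt_y).
exact: mem_head.
Qed.

Lemma nth_cols V c : nth [::] (cols V) c = column V c.
Proof.
case: (ltnP c (ncols V)) => [lt_c|le_c]; first by rewrite nth_mkseq.
rewrite nth_default ?size_mkseq //; apply/esym/eqP; rewrite -size_eq0.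
rewrite /column size_map size_filter -leqn0 leqNgt -has_count.
apply/hasPn => rw rw_in; rewrite -leqNgt; apply: leq_trans le_c.
exact/leq_foldr_maxn/map_f.
Qed.

Lemma filling_ext X Y :
    wf_sky X -> wf_sky Y -> positive_entries X -> positive_entries Y ->
  (forall r c, entry X r c = entry Y r c) -> X = Y.
Proof.
move=> wfX wfY pX pY eXY.
have eq_row r : row X r = row Y r.
  have eq_lt c : (c < size (row X r)) = (c < size (row Y r)).
    by rewrite -!entry_gt0 ?eXY.
  have eq_sz : size (row X r) = size (row Y r).
    by apply/eqP; rewrite eqn_leq leqNgt eq_lt ltnn leqNgt -eq_lt ltnn.
  by apply: (@eq_from_nth _ 0) => // c _; apply: eXY.
have le_sz A B : wf_sky A -> (forall r, row A r = row B r) -> size A <= size B.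
  case=> [-> //|lastA] eAB; rewrite leqNgt; apply/negP => ltBA; apply: lastA.
  by rewrite -nth_last -/(row A _) eAB row_default //; case: (size A) ltBA.
apply: (@eq_from_nth _ [::]) => [|r _]; last exact: eq_row.
by apply/eqP; rewrite eqn_leq !le_sz.
Qed.

(** * The quasi-Yamanouchi condition as a property of the column sets *)

Lemma quasiYamE X : quasiYam X <->
  forall c x, x \in column X c -> (forall c', c' < c -> x \notin column X c') ->
  c = 0 \/ exists2 c', c <= c' & x.+1 \in column X c'.
Proof.
split=> [qX c x /columnP [r cr <-] first_x|qX r c cr first_r].
  case: (qX r c cr) => [r' c' lt_c cr' eq_x|->|[r' [c' [le_c [cr' eq_x]]]]].
  - by case/columnP: (first_x _ lt_c); exists r'.
  - by left.
  - by right; exists c' => //; apply/columnP; exists r'.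
case: (qX c (entry X r c)) => [|c' lt_c|->|[c' le_c /columnP [r' cr' eq_x]]].
- by apply/columnP; exists r.
- by apply/columnP => -[r' cr' eq_x]; apply: (first_r r' c').
- by left.
- by right; exists r', c'.
Qed.

Lemma eq_quasiYam X Y :
  (forall c, column X c =i column Y c) -> quasiYam X -> quasiYam Y.
Proof.
move=> eXY /quasiYamE qX; apply/quasiYamE => c x; rewrite -eXY => x_c first_x.
case: (qX c x x_c) => [c' /first_x|->|[c' le_c x_c']]; first by rewrite eXY.
  by left.
by right; exists c'; rewrite -?eXY.
Qed.

(** * Reverse tableaux and their columns *)

Lemma revSSYT_wf T : revSSYT T -> wf_sky T.
Proof.
case=> ne _; case: T ne => [|rw T] ne; [by left|right].
by rewrite -nth_last /= => E; move: (ne (size T) (ltnSn _)); rewrite /row E.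
Qed.

Lemma revSSYT_cols T r s c : revSSYT T -> r < s -> cell T s c ->
  cell T r c /\ entry T s c < entry T r c.
Proof.
case=> _ [shape [_ [_ strict]]]; elim: s => // s IH.
have step : cell T s.+1 c -> cell T s c.
  by move=> cs; apply: leq_trans (cs) (shape _ (cell_size cs)).
rewrite ltnS leq_eqVlt => /predU1P [->|lt_r] cs.
  by split; [apply: step|apply: strict].
have [cr lt_rs] := IH lt_r (step cs).
by split=> //; apply: ltn_trans lt_rs; apply: strict.
Qed.

Lemma revSSYT_col_distinct T : revSSYT T -> col_distinct T.
Proof.
move=> revT r s c cr cs eq_rs; case: (ltngtP r s) => // lt_rs.
  by case: (revSSYT_cols revT lt_rs cs); rewrite eq_rs ltnn.
by case: (revSSYT_cols revT lt_rs cr); rewrite eq_rs ltnn.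
Qed.

Lemma revSSYT_column_inj V W : revSSYT V -> revSSYT W ->
  (forall c, column V c =i column W c) -> V = W.
Proof.
move=> revV revW eVW.
have [[_ [_ [pV _]]] [_ [_ [pW _]]]] := (revV, revW).
apply: filling_ext (revSSYT_wf revV) (revSSYT_wf revW) (pV) (pW) _ => r c.
have le_entry A B r' : revSSYT A -> revSSYT B ->
    positive_entries A -> column A c =i column B c ->
    (forall s, s < r' -> entry A s c = entry B s c) ->
    entry A r' c <= entry B r' c.
  move=> revA revB pA eAB IH; rewrite leqNgt; apply/negP => lt_BA.
  have cA : cell A r' c by rewrite /cell -entry_gt0 // (leq_ltn_trans _ lt_BA).
  have : entry A r' c \in column B c by rewrite -eAB; apply/columnP; exists r'.
  case/columnP=> j cj eq_j; case: (ltngtP j r') => [lt_j|lt_j|eq_jr].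
  - have [_] := revSSYT_cols revA lt_j cA.
    by rewrite (IH j) // eq_j ltnn.
  - have [_] := revSSYT_cols revB lt_j cj; lia.
  - by move: lt_BA; rewrite -eq_j eq_jr ltnn.
elim/ltn_ind: r => r IH; apply/eqP; rewrite eqn_leq.
apply/andP; split; apply: le_entry => //.
  by move=> x; rewrite eVW.
by move=> s lt_s; rewrite IH.
Qed.

(** The entries at least [x] form an initial segment of a decreasing list; [0 < x] keeps out the
    default value 0. *)
Lemma leq_nth_sorted s i x : sorted geq s -> 0 < x ->
  (x <= nth 0 s i) = (i < count (leq x) s).
Proof.
move=> + x_gt0; elim: s i => [|y s IH] i srt; first by rewrite nth_nil leqNgt x_gt0.
have srt' := path_sorted srt.
have le_y : all (geq y) s by rewrite (order_path_min _ srt) // => a b d /= h /leq_trans; apply.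
case: (leqP x y) => [le_x|lt_y] /=.
  by rewrite le_x; case: i => [|i] /=; rewrite ?le_x // IH // add1n ltnS.
rewrite [x <= y]leqNgt lt_y add0n.
have -> : count (leq x) s = 0.
  apply/eqP; rewrite -leqn0 leqNgt -has_count; apply/hasPn => z /(allP le_y) /=.
  by move=> le_z; rewrite -ltnNge (leq_ltn_trans le_z).
case: i => [|i] /=; first by rewrite leqNgt lt_y.
case: (ltnP i (size s)) => [lt_i|le_i]; last by rewrite nth_default // leqNgt x_gt0.
by rewrite leqNgt (leq_ltn_trans _ lt_y) //; apply: (allP le_y); rewrite mem_nth.
Qed.

Lemma find_eq0_nonincreasing (f : nat -> nat) n c :
  (forall c, f c.+1 <= f c) -> f n = 0 ->
  (c < find (fun c => f c == 0) (iota 0 n.+1)) = (0 < f c).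
Proof.
move=> mono fn0; set k := find _ _.
have has0 : has (fun c => f c == 0) (iota 0 n.+1).
  by apply/hasP; exists n; rewrite ?mem_iota ?add0n /= ?fn0 ?ltnSn.
have k_lt : k < n.+1 by move: has0; rewrite has_find size_iota.
have fk0 : f k = 0 by move: (nth_find 0 has0); rewrite -/k nth_iota // => /eqP.
have f0 d : f (k + d) = 0.
  elim: d => [|d IH]; first by rewrite addn0.
  by apply/eqP; rewrite -leqn0 addnS -IH.
case: (ltnP c k) => [lt_c|le_c]; last by rewrite -(subnKC le_c) f0.
have := before_find 0 lt_c; rewrite nth_iota ?add0n; last exact: ltn_trans k_lt.
by rewrite lt0n => ->.
Qed.

(* Sorting every column of X: weak decrease along rows survives because it only
   expresses, threshold by threshold, that column c has at least as many entries
   above the threshold as column c.+1. *)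
Lemma revSSYT_of_columns X :
  positive_entries X -> rows_weakly_decr X -> col_distinct X ->
  exists2 V, revSSYT V & forall c, column V c =i column X c.
Proof.
move=> pX wX dX.
pose S c := sort geq (column X c).
have geq_total : total geq by move=> a b; apply: leq_total.
have S_sorted c : sorted geq (S c) by apply: sort_sorted.
have S_uniq c : uniq (S c) by rewrite sort_uniq column_uniq.
have S_mem c : S c =i column X c by apply: mem_sort.
have S_pos c x : x \in S c -> 0 < x.
  by rewrite S_mem => /columnP [r /pX + <-].
have S_count c x : count (leq x) (S c) = count (leq x) (column X c).
  by apply/permP; rewrite perm_sort.
pose e i c := nth 0 (S c) i.
have e_gt0 i c : (0 < e i c) = (i < size (S c)).
  case: (ltnP i (size (S c))) => [lt_i|le_i]; last by rewrite /e nth_default.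
  by apply: (S_pos c); apply: mem_nth.
have e_wd i c : e i c.+1 <= e i c.
  case: (posnP (e i c.+1)) => [-> //|e_pos].
  have : e i c.+1 <= nth 0 (S c.+1) i by [].
  rewrite leq_nth_sorted // S_count => lt_i.
  rewrite leq_nth_sorted // S_count; apply: leq_trans lt_i _.
  exact: count_column.
have e_ncols i : e i (ncols X) = 0.
  have col0 : column X (ncols X) = [::] by rewrite -nth_cols nth_default ?size_mkseq.
  by rewrite /e /S col0 nth_nil.
(* Row [i] stops at its first zero. The search succeeds because column [ncols X] is empty. *)
pose len i := find (fun c => e i c == 0) (iota 0 (ncols X).+1).
have lenE i c : (c < len i) = (0 < e i c) by rewrite find_eq0_nonincreasing.
pose V := mkseq (fun i => mkseq (e i) (len i)) (size (S 0)).
have sizeV : size V = size (S 0) by rewrite size_mkseq.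
have S_sub i c : i < size (S c) -> i < size (S 0).
  rewrite -!e_gt0; elim: c => // c IH pos; apply: IH; exact: leq_trans (e_wd _ _).
have cellE i c : (c < size (row V i)) = (i < size (S c)).
  case: (ltnP i (size (S 0))) => [lt_i|le_i].
    by rewrite /row nth_mkseq // size_mkseq lenE e_gt0.
  rewrite row_default ?sizeV //=; apply/esym/negbTE; rewrite -leqNgt leqNgt.
  by apply/negP => /S_sub; rewrite ltnNge le_i.
have entryE i c : cell V i c -> entry V i c = e i c.
  rewrite /cell => cic; have lt_i := cell_size cic; move: (cic).
  by rewrite /entry /row nth_mkseq -?sizeV // size_mkseq => ?; rewrite nth_mkseq.
have colV c : column V c =i column X c.
  move=> x; rewrite -S_mem; apply/columnP/(nthP 0) => [[i ci <-]|[i lt_i <-]].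
    by exists i; rewrite -?cellE // entryE.
  have ci : cell V i c by rewrite /cell cellE.
  by exists i; rewrite ?entryE.
exists V => //; split=> [i lt_i|]; first by rewrite cellE -sizeV.
split=> [i lt_i|].
  rewrite leqNgt; apply/negP; rewrite cellE => lt_i1.
  have : cell V i.+1 (size (row V i)).
    by rewrite /cell; move: lt_i1; rewrite -cellE.
  rewrite /cell cellE => /ltnW; rewrite -cellE ltnn => //.
split=> [i c ci|]; first by rewrite entryE // e_gt0 -cellE.
split=> [i c ci|i c ci]; first by rewrite !entryE //; apply: cell_le ci.
have ci' : cell V i c by rewrite /cell cellE ltnW // -cellE.
have lt_i : i.+1 < size (S c) by rewrite -cellE.
rewrite !entryE // ltn_neqAle nth_uniq // ?neq_ltn ?ltnSn ?orbT //; last exact: ltnW.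
have gt_trans : transitive geq by move=> a b d /= h /leq_trans; apply.
by have := sorted_leq_nth gt_trans leqnn 0 (S_sorted c); apply; rewrite ?inE // ltnW.
Qed.

(** The argument common to both maps. A tableau is recovered from the columns of its image. A
    preimage of [X] is the tableau obtained by sorting the columns of [X]: its image has the same
    columns as [X], hence equals [X]. *)
Lemma bij_between_quasiYam B f :
    (forall V, revSSYT V -> B (f V) /\ forall c, column (f V) c =i column V c) ->
    (forall X, B X ->
       positive_entries X /\ rows_weakly_decr X /\ col_distinct X) ->
    (forall X Y, B X -> B Y -> (forall c, column X c =i column Y c) -> X = Y) ->
  bij_between QrevSSYT (fun X => B X /\ quasiYam X) f.
Proof.
move=> fP B_basic B_inj; split; [|split].
- move=> V [/fP [BfV eV] qV]; split=> //; apply: eq_quasiYam qV => c x.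
  by rewrite eV.
- move=> V W [revV _] [revW _] eq_f; apply: revSSYT_column_inj => // c x.
  by have [[_ <-] [_ <-]] := (fP V revV, fP W revW); rewrite eq_f.
- move=> X [BX qX]; have [pX [wX dX]] := B_basic X BX.
  have [V revV eV] := revSSYT_of_columns pX wX dX; have [BfV efV] := fP V revV.
  exists V; split.
    by split=> //; apply: eq_quasiYam qX => c x; rewrite eV.
  by apply: B_inj => // c x; rewrite efV eV.
Qed.

(** * Column filling and semi-skyline fillings *)

(* Together with the elementary conditions this replaces the two triple
   conditions of ASSF.  Unlike them it does not refer to row lengths, and it is
   what "lowest available row" says literally (an absent entry reads as 0). *)
Definition greedy (X : filling) : Prop :=
  forall r s c, r < s -> cell X s c.+1 ->
    entry X s c.+1 <= entry X r c -> entry X s c.+1 < entry X r c.+1.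

Lemma greedy_entry0 X r s c : rows_weakly_decr X -> greedy X -> r < s ->
  entry X s c.+1 <= entry X r c -> entry X s c.+1 <= entry X r c.+1.
Proof.
move=> wX gX lt_rs le_c; case: (ltnP c.+1 (size (row X s))) => [cs|le_s].
  exact/ltnW/gX.
by rewrite {1}/entry nth_default.
Qed.

(** If the higher row is longer, Type B triples carry the strict inequality of the first column
    along both rows, so the premise of [greedy] fails. Otherwise the conclusion is read off a Type A
    triple. *)
Lemma ASSF_greedy X : ASSF X -> greedy X.
Proof.
case=> _ [pX [wX [dX [triA [triB first]]]]].
have descent r s c : r < s -> size (row X r) < size (row X s) ->
    cell X s c -> cell X r c -> entry X r c < entry X s c.
  move=> lt_rs lt_sz; elim: c => [|c IH] cs cr.
    by rewrite !first // ltnS.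
  have [cs' cr'] := (cell_le (leqnSn c) cs, cell_le (leqnSn c) cr).
  have lt_c := IH cs' cr'.
  have := triB _ _ _ lt_rs lt_sz cs' cs cr'; have := wX _ _ cr.
  by rewrite /inversion_triple; lia.
move=> r s c lt_rs cs le_sr.
have cr : cell X r c.
  by rewrite /cell -entry_gt0 // (leq_trans _ le_sr) // entry_gt0.
case: (leqP (size (row X s)) (size (row X r))) => [le_sz|lt_sz].
  have cr' : cell X r c.+1 by apply: leq_trans cs le_sz.
  have := triA _ _ _ lt_rs le_sz cr cr' cs.
  by rewrite /inversion_triple; lia.
have cs' := cell_le (leqnSn c) cs.
have := triB _ _ _ lt_rs lt_sz cs' cs cr.
have := descent _ _ _ lt_rs lt_sz cs' cr.
by rewrite /inversion_triple; lia.
Qed.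

Lemma greedy_ASSF X :
    wf_sky X -> positive_entries X -> rows_weakly_decr X -> col_distinct X ->
    (forall r, cell X r 0 -> entry X r 0 = r.+1) -> greedy X ->
  ASSF X.
Proof.
move=> wfX pX wX dX first gX; do ![split=> //].
  move=> r s c lt_rs le_sz cr cr' cs.
  have := gX _ _ _ lt_rs cs; have := wX _ _ cr'.
  by rewrite /inversion_triple; lia.
move=> r s c lt_rs lt_sz cs cs' cr.
suff lt_c : entry X r c < entry X s c.+1.
  by have := wX _ _ cs'; rewrite /inversion_triple; lia.
rewrite ltnNge; apply/negP => le_c.
(* Once row r beats row s at some step it keeps doing so, hence is no shorter. *)
have keep d : entry X s (c + d).+1 <= entry X r (c + d).
  elim: d => [|d IH]; first by rewrite addn0.
  rewrite addnS; apply: leq_trans (entry_wd _ _ wX) _; exact: greedy_entry0.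
have szr : 0 < size (row X r) by apply: leq_ltn_trans cr.
have le_last : entry X s (size (row X r)).-1.+1 <= entry X r (size (row X r)).-1.
  by rewrite -(subnKC (_ : c <= (size (row X r)).-1)) ?keep // -ltnS prednK.
(* At the last column of row [r], [greedy] would demand a positive entry in an absent cell, which
   reads as 0. *)
have := gX r s (size (row X r)).-1 lt_rs.
rewrite /cell prednK // in le_last * => /(_ lt_sz le_last).
by rewrite {2}/entry nth_default.
Qed.

(** * Uniqueness of a semi-skyline filling with given columns *)

Lemma mem_column X r c : positive_entries X -> 0 < entry X r c ->
  entry X r c \in column X c.
Proof. by move=> pX; rewrite entry_gt0 // => cr; apply/columnP; exists r. Qed.

(** Suppose [x] sits in different rows of [A] and [B]. The filling with [x] in the higher row must,
    being greedy, have an entry above [x] in the lower one. By [agree] the other filling has that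
    entry there too, although it has [x] in this place. *)
Lemma greedy_step A B c x s :
    positive_entries A -> positive_entries B -> greedy A -> greedy B ->
    rows_weakly_decr A -> rows_weakly_decr B ->
    column A c.+1 =i column B c.+1 -> (forall r, entry A r c = entry B r c) ->
    (forall z r, x < z -> entry A r c.+1 = z <-> entry B r c.+1 = z) ->
  0 < x -> entry A s c.+1 = x -> entry B s c.+1 = x.
Proof.
move=> pA pB gA gB wA wB eAB eqc agree x_gt0 eA.
have := mem_column pA (r := s) (c := c.+1); rewrite eA eAB.
case/(_ x_gt0)/columnP => s' cs' eB.
have cs : cell A s c.+1 by rewrite /cell -entry_gt0 // eA.
case: (ltngtP s s') => [lt_s|lt_s|->] //.
  have := gB _ _ _ lt_s cs'; rewrite eB -eqc -{1}eA entry_wd // => /(_ isT) lt_x.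
  by have := (agree _ s lt_x).2 erefl; lia.
have := gA _ _ _ lt_s cs; rewrite eA eqc -{1}eB entry_wd // => /(_ isT) lt_x.
by have := (agree _ s' lt_x).1 erefl; lia.
Qed.

Lemma ASSF_column_inj X Y : ASSF X -> ASSF Y ->
  (forall c, column X c =i column Y c) -> X = Y.
Proof.
move=> sX sY eXY; have [gX gY] := (ASSF_greedy sX, ASSF_greedy sY).
case: sX sY => wfX [pX [wX [_ [_ [_ fX]]]]] [wfY [pY [wY [_ [_ [_ fY]]]]]].
apply: filling_ext => // r c; elim: c r => [|c IH] r.
  have e0 A : positive_entries A -> (forall r, cell A r 0 -> entry A r 0 = r.+1) ->
      entry A r 0 = if r.+1 \in column A 0 then r.+1 else 0.
    move=> pA fA; case: columnP => [[s cs]|notin].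
      by rewrite fA // => -[<-]; apply: fA.
    apply/eqP; rewrite -leqn0 leqNgt entry_gt0 //; apply/negP => cr.
    by apply: notin; exists r => //; apply: fA.
  by rewrite !e0 // eXY.
(* Within a column the values are treated from the largest down; [n] bounds how far [x] is from
   exceeding the maximum. *)
have agree n x s : 0 < x -> foldr maxn 0 (column X c.+1) < x + n ->
    entry X s c.+1 = x <-> entry Y s c.+1 = x.
  elim: n x s => [|n IHn] x s x_gt0 lt_max.
    have noX : x \notin column X c.+1.
      by apply: contraTN lt_max => /leq_foldr_maxn; rewrite addn0 -leqNgt.
    have noY : x \notin column Y c.+1 by rewrite -eXY.
    by split=> e; [case/negP: noX|case/negP: noY]; rewrite -e mem_column // e.
  have above z r' : x < z -> entry X r' c.+1 = z <-> entry Y r' c.+1 = z.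
    by move=> lt_x; apply: IHn; lia.
  split; apply: greedy_step => //; first by move=> y; rewrite eXY.
  by move=> z r' lt_x; split=> /(above z r' lt_x).
have E x : 0 < x -> entry X r c.+1 = x <-> entry Y r c.+1 = x.
  by move=> x_gt0; apply: (agree (foldr maxn 0 (column X c.+1)).+1); lia.
case: (posnP (entry X r c.+1)) => [eX|X_gt0]; last by apply/esym/(E _ X_gt0).
case: (posnP (entry Y r c.+1)) => [-> //|Y_gt0]; exact/(E _ Y_gt0).
Qed.

(* Γ in the middle of column c: columns before c are those of V, and done is the
   set of entries already placed in column c. *)
Record partial_fill V c (done : seq nat) (Y : filling) : Prop := PartialFill {
  pf_wf : wf_sky Y;
  pf_pos : positive_entries Y;
  pf_wd : rows_weakly_decr Y;
  pf_dist : col_distinct Y;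
  pf_first : forall r, cell Y r 0 -> entry Y r 0 = r.+1;
  pf_greedy : greedy Y;
  pf_size : forall r, size (row Y r) <= c.+1;
  pf_prev : forall c', c' < c -> column Y c' =i column V c';
  pf_done : column Y c =i done
}.

(** * The placement steps of [Gamma] *)

Lemma placeP c x X :
    has (fun rw => (size rw == c) && (x <= nth 0 rw c.-1)) X ->
  exists i, [/\ size (row X i) = c, i < size X, x <= entry X i c.-1,
    forall r, r < i -> size (row X r) = c -> entry X r c.-1 < x &
    size (place c x X) = size X /\
    forall r, row (place c x X) r = if r == i then rcons (row X i) x else row X r].
Proof.
move=> hasX; rewrite /place; set p := fun rw => _ in hasX *; set i := find _ _.
have lt_i : i < size X by rewrite -has_find.
have /andP [/eqP sz_i le_x] := nth_find [::] hasX.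
exists i; split=> // [r lt_r sz_r|].
  by have := before_find [::] lt_r; rewrite /p -/(row X r) sz_r eqxx ltnNge /entry => /= ->.
rewrite lt_i; split; first by rewrite size_set_nth; apply/maxn_idPr.
by move=> r; rewrite /row nth_set_nth /=.
Qed.

Lemma place_partial V c (x : nat) done Y :
    revSSYT V -> partial_fill V c.+1 done Y ->
    x \in column V c.+1 -> {in done, forall y, x < y} ->
    uniq done -> {subset done <= column V c.+1} ->
  partial_fill V c.+1 (x :: done) (place c.+1 x Y).
Proof.
move=> revV [wfY pY wY dY fY gY szY prevY doneY] xV lt_done uniq_done sub_done.
have [_ [_ [pV [wV _]]]] := revV; have dV := revSSYT_col_distinct revV.
have x_gt0 : 0 < x by case/columnP: xV => r /pV + <-.
(* Otherwise every row with an entry at least [x] in column [c] is already filled in column [c.+1],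
   so there are at most [size done] such rows. But [x] and [done] together are more than that many
   entries at least [x] in column [c.+1] of [V], and column [c] of [V] has no fewer. *)
have fits : has (fun rw => (size rw == c.+1) && (x <= nth 0 rw c)) Y.
  apply: contraT => /hasPn none.
  have le_cnt : count (leq x) (column Y c) <= size (column Y c.+1).
    rewrite !columnE count_map count_filter size_map size_filter.
    apply: sub_count => r /=; case/andP=> le_x cr.
    have /none : row Y r \in Y by rewrite mem_nth // (cell_size cr).
    by rewrite -/(entry Y r c) le_x andbT; lia.
  have eq_done : size (column Y c.+1) = size done.
    by apply/perm_size/uniq_perm => //; apply: column_uniq.
  have eq_cnt : count (leq x) (column Y c) = count (leq x) (column V c).
    by apply/permP/uniq_perm; rewrite ?column_uniq //; apply: prevY.
  have lt_cnt : size done < count (leq x) (column V c.+1).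
    rewrite -size_filter -/(size (x :: done)); apply: uniq_leq_size.
      by rewrite /= uniq_done andbT; apply/negP => /lt_done; rewrite ltnn.
    move=> y; rewrite inE mem_filter => /predU1P [->|y_done].
      by rewrite leqnn.
    by rewrite ltnW ?lt_done ?sub_done.
  by have := count_column c x wV; lia.
case: (placeP fits) => i [sz_i lt_i le_x first_i [sz_Y' rowE]].
set Y' := place c.+1 x Y in sz_Y' rowE *.
have sizeE r : size (row Y' r) = size (row Y r) + (r == i).
  by rewrite rowE; case: eqP => [->|_]; rewrite ?size_rcons ?addn1 ?addn0.
have entryE r c' : entry Y' r c' = if (r == i) && (c' == c.+1) then x else entry Y r c'.
  rewrite /entry rowE; case: eqP => //= ->; rewrite nth_rcons sz_i.
  by case: ltngtP => // lt_c; rewrite nth_default // sz_i ltnW.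
have cellE r c' : cell Y' r c' <-> cell Y r c' \/ r = i /\ c' = c.+1.
  rewrite /cell sizeE; case: eqP => [->|ne]; rewrite ?addn1 ?addn0 ?sz_i; first by lia.
  by split; [left|case=> // -[/ne]].
have done_x r : cell Y r c.+1 -> x < entry Y r c.+1.
  by move=> cr; apply: lt_done; rewrite -doneY; apply/columnP; exists r.
have not_i : ~ cell Y i c.+1 by rewrite /cell sz_i ltnn.
split.
- right; rewrite -nth_last -/(row _ _) rowE sz_Y'.
  case: eqP => _; first by case: (row Y i).
  by case: wfY lt_i => [->//|]; rewrite -nth_last.
- move=> r c' /cellE [cr|[-> ->]]; rewrite entryE ?eqxx //.
  by case: ifP => // _; apply: pY.
- move=> r c' /cellE [cr|[-> [->]]]; last first.
    by rewrite !entryE eqxx /= eqxx (ltn_eqF (ltnSn c)).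
  rewrite !entryE; case: (r =P i) => [eq_r|] /=; last by move=> _; apply: wY.
  have [ne ne'] : c' != c.+1 /\ c'.+1 != c.+1.
    by move: cr; rewrite /cell eq_r sz_i; lia.
  by rewrite (negbTE ne) (negbTE ne'); apply: wY.
- move=> r s c' cr cs; rewrite !entryE.
  case/cellE: cr cs => [cr|[-> ->]] /cellE [cs|[-> e]].
  + have noti t : cell Y t c' -> (t == i) && (c' == c.+1) = false.
      by move=> ct; apply/negP => /andP [/eqP et /eqP ec]; apply: not_i; rewrite -et -ec.
    by rewrite !noti //; apply: dY.
  + subst c'; rewrite !eqxx /=; case: eqP => // _ /= eq_x.
    by have := done_x _ cr; lia.
  + rewrite !eqxx andbT; case: eqP => [->//|_] /= eq_x.
    by have := done_x _ cs; lia.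
  + by [].
- move=> r; rewrite entryE andbF => /cellE [|[_ //]]; exact: fY.
- move=> r s c' lt_rs /cellE [cs|[es [ec]]]; rewrite !entryE.
    have -> : (s == i) && (c'.+1 == c.+1) = false.
      by apply/negP => /andP [/eqP et /eqP ec]; apply: not_i; rewrite -et -ec.
    have -> : (r == i) && (c' == c.+1) = false.
      by apply/negP => /andP [_ /eqP ec]; have := leq_trans cs (szY s); rewrite ec; lia.
    move=> /(gY _ _ _ lt_rs cs) lt_e; case: ifP => // /andP [/eqP er /eqP ec].
    (* Here [r] is the row receiving [x]. Its cell was empty before and read as 0, which contradicts
       [greedy] for the old filling. *)
    move: lt_e; rewrite er ec {2}/entry nth_default // sz_i //.
  (* For the new entry: a lower row with an entry at least [x] in column [c] was not free, so it
     holds an entry placed earlier, hence larger. *)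
  rewrite -es (ltn_eqF lt_rs) ec !eqxx /= => le_r; apply: done_x; rewrite /cell ltn_neqAle.
  have cr : c < size (row Y r) by rewrite -entry_gt0 // (leq_trans x_gt0).
  rewrite cr andbT eq_sym; apply/eqP => sz_r.
  by have := first_i r; rewrite -es => /(_ lt_rs sz_r) /=; lia.
- move=> r; rewrite sizeE; case: eqP => [->|_]; rewrite ?sz_i ?addn1 // addn0; exact: szY.
- move=> c' lt_c y; rewrite -prevY //; apply/columnP/columnP => -[r cr].
    rewrite entryE (ltn_eqF lt_c) andbF; exists r => //.
    by case/cellE: cr => // -[_ e]; move: lt_c; rewrite e ltnn.
  by move=> e; exists r; [apply/cellE; left|rewrite entryE (ltn_eqF lt_c) andbF].
- move=> y; rewrite inE -doneY; apply/columnP/predU1P => [[r /cellE cr]|].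
    rewrite entryE eqxx andbT; case: eqP => [_ <-|ne <-]; [by left|right].
    by apply/columnP; exists r => //; case: cr => // -[/ne].
  case=> [->|/columnP [r cr <-]].
    by exists i; [apply/cellE; right|rewrite entryE !eqxx].
  exists r; [by apply/cellE; left|rewrite entryE; case: eqP => //= er].
  by case: not_i; rewrite -er.
Qed.

Lemma partial_fill_next V c done Y :
  partial_fill V c done Y -> done =i column V c -> partial_fill V c.+1 [::] Y.
Proof.
case=> wfY pY wY dY fY gY szY prevY doneY eq_done; split=> //.
- by move=> r; apply: leqW.
- move=> c'; rewrite ltnS leq_eqVlt => /predU1P [->|/prevY //] x.
  by rewrite doneY eq_done.
- move=> x; rewrite in_nil; apply/columnP => -[r]; rewrite /cell => cr.
  by have := szY r; rewrite leqNgt cr.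
Qed.

(** As [s] decreases, each entry placed is smaller than all placed before it, which [place_partial]
    requires. [catrev] puts the latest entry first. *)
Lemma fill_partial V c (s done : seq nat) Y :
    revSSYT V -> partial_fill V c.+1 done Y -> sorted gtn s ->
    {subset s <= column V c.+1} -> {in s & done, forall x y, x < y} ->
    uniq done -> {subset done <= column V c.+1} ->
  partial_fill V c.+1 (catrev s done) (foldl (fun Y x => place c.+1 x Y) Y s).
Proof.
move=> revV; elim: s done Y => //= x s IH done Y fillY srt sub_s lt_sd uniq_done sub_done.
have gtn_trans : transitive gtn by move=> a b d /= ab bd; apply: ltn_trans ab.
have xV : x \in column V c.+1 by apply: sub_s; apply: mem_head.
have lt_x : {in done, forall y, x < y} by move=> y; apply: lt_sd; apply: mem_head.
apply: IH (path_sorted srt) _ _ _ _.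
- exact: place_partial.
- by move=> y y_s; apply: sub_s; rewrite in_cons y_s orbT.
- move=> y z y_s; rewrite in_cons => /predU1P [->|].
    exact: (allP (order_path_min gtn_trans srt)).
  by apply: lt_sd; rewrite in_cons y_s orbT.
- by rewrite /= uniq_done andbT; apply/negP => /lt_x; rewrite ltnn.
- by move=> y; rewrite in_cons => /predU1P [-> //|/sub_done].
Qed.

Lemma Gamma_partial V n : revSSYT V ->
  let C1 := column V 0 in
  let X0 := mkseq (fun i => if i.+1 \in C1 then [:: i.+1] else [::]) (foldr maxn 0 C1) in
  partial_fill V n.+1 [::] (foldl (fill_col (cols V)) X0 (iota 1 n)).
Proof.
move=> revV C1 X0; have [_ [_ [pV [wV _]]]] := revV.
elim: n => [|n IH]; last first.
  have -> : iota 1 n.+1 = iota 1 n ++ [:: n.+1] by rewrite -[in LHS](addn1 n) iotaD add1n.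
  rewrite foldl_cat /= {1}/fill_col nth_cols.
  have uniqV : uniq (column V n.+1) by apply/column_uniq/revSSYT_col_distinct.
  set s := sort _ _.
  have srt : sorted gtn s.
    rewrite gtn_sorted_uniq_geq sort_uniq uniqV /=; apply: sort_sorted => a b.
    exact: leq_total.
  apply: partial_fill_next (fill_partial revV IH srt _ _ _ _) _ => //.
    by move=> y; rewrite mem_sort.
  by move=> y; rewrite catrevE cats0 mem_rev mem_sort.
rewrite /=; have rowE r : row X0 r = if r.+1 \in C1 then [:: r.+1] else [::].
  case: (ltnP r (foldr maxn 0 C1)) => [lt_r|le_r]; first by rewrite /row nth_mkseq.
  rewrite row_default ?size_mkseq //; case: ifP => // /leq_foldr_maxn.
  by rewrite ltnNge le_r.
have cellE r c : cell X0 r c <-> r.+1 \in C1 /\ c = 0.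
  rewrite /cell rowE; case: ifP => _; last by split=> // -[].
  by case: c => [|c]; split=> // -[].
have entryE r c : cell X0 r c -> entry X0 r c = r.+1.
  by case/cellE => r_in ->; rewrite /entry rowE r_in.
have col0 : column X0 0 =i C1.
  move=> x; apply/columnP/idP => [[r cr <-]|x_C].
    by rewrite entryE //; case/cellE: cr.
  have x_gt0 : 0 < x by case/columnP: x_C => r /pV + <-.
  have cx : cell X0 x.-1 0 by apply/cellE; rewrite prednK.
  by exists x.-1; rewrite ?entryE ?prednK.
(* The initial filling counts as column 0 with all its entries already placed. *)
apply: (@partial_fill_next _ _ C1) => //; split=> //.
- case: (posnP (foldr maxn 0 C1)) => [m0|m_gt0]; first by left; rewrite /X0 m0.
  right; rewrite -nth_last -/(row _ _) rowE size_mkseq prednK //.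
  by rewrite foldr_maxn_mem.
- by move=> r c cr; rewrite entryE.
- by move=> r c /cellE [_].
- move=> r s c cr cs; rewrite !entryE //; exact: succn_inj.
- by move=> r; apply: entryE.
- by move=> r s c _ /cellE [_].
- by move=> r; rewrite rowE; case: ifP.
Qed.

Lemma Gamma_ASSF V : revSSYT V ->
  ASSF (Gamma V) /\ forall c, column (Gamma V) c =i column V c.
Proof.
move=> revV; have := Gamma_partial (size (cols V)).-1 revV.
rewrite /Gamma nth_cols; set X := foldl _ _ _.
case=> wfX pX wX dX fX gX szX prevX doneX; split; first exact: greedy_ASSF.
move=> c; case: (ltnP c (size (cols V)).-1.+1) => [/prevX //|lt_c] x.
have -> : column V c = [::].
  rewrite -nth_cols nth_default //; lia.
rewrite in_nil; apply/columnP => -[r cr _].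
(* A cell in column [c] would give one in column [(size (cols V)).-1.+1], where nothing has been
   placed. *)
have : entry X r (size (cols V)).-1.+1 \in column X (size (cols V)).-1.+1.
  by apply/columnP; exists r => //; apply: cell_le cr.
by rewrite doneX.
Qed.

(** * Right row-filling and quasi-key tableaux *)

(* The rows of a quasi-key tableau in the order in which ψ extracts them. *)
Record extracted (R : filling) : Prop := Extracted {
  ex_pos : positive_entries R;
  ex_wd : rows_weakly_decr R;
  ex_dist : col_distinct R;
  ex_nonempty : forall r, r < size R -> cell R r 0;
  ex_shape : forall i j c, i < j -> cell R j c -> cell R i c;
  (* Row i takes the least available entry of column c that is at least its
     entry in column c.+1, the latter reading as 0 past the end of the row. *)
  ex_least : forall i j c, i < j -> cell R j c ->
    entry R i c.+1 <= entry R j c -> entry R i c < entry R j c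
}.

(** Suppose row [i] of [B] has the larger entry. The entry of [A] then occurs in another row of [B]:
    in an earlier row it would repeat in [A], and in a later one it would contradict leastness in
    [B]. If row [i] of [A] has no such entry, the entry of [B] is located in [A] instead, and the
    shape of [A] excludes a later row. *)
Lemma extracted_step A B c i : extracted A -> extracted B ->
    column A c =i column B c ->
    (forall r, entry A r c.+1 = entry B r c.+1) ->
    (forall j, j < i -> entry A j c = entry B j c) ->
  entry B i c <= entry A i c.
Proof.
move=> exA exB eAB eq_next eq_above; rewrite leqNgt; apply/negP => lt_AB.
have [pA pB] := (ex_pos exA, ex_pos exB).
have cB : cell B i c by rewrite /cell -entry_gt0 // (leq_ltn_trans _ lt_AB).
case: (posnP (entry A i c)) => [A0|A_gt0].
  have := mem_column pB (r := i) (c := c); rewrite (leq_ltn_trans _ lt_AB) // -eAB.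
  case/(_ isT)/columnP => j cj eq_j; case: (ltngtP j i) => [lt_j|lt_j|eq_ji].
  - have cBj : cell B j c by rewrite /cell -entry_gt0 // -(eq_above j) // entry_gt0.
    by have := lt_j; rewrite (ex_dist exB cBj cB) ?ltnn // -(eq_above j).
  - by have := ex_shape exA lt_j cj; rewrite /cell -entry_gt0 // A0.
  - by move: lt_AB; rewrite -eq_j eq_ji ltnn.
have cA : cell A i c by rewrite /cell -entry_gt0.
have := mem_column pA A_gt0; rewrite eAB => /columnP [j cj eq_j].
case: (ltngtP j i) => [lt_j|lt_j|eq_ji].
- have cAj : cell A j c by rewrite /cell -entry_gt0 // (eq_above j) // entry_gt0.
  by have := lt_j; rewrite (ex_dist exA cAj cA) ?ltnn // (eq_above j).
- have := ex_least exB lt_j cj.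
  by rewrite eq_j -eq_next (entry_wd _ _ (ex_wd exA)) ltnNge (ltnW lt_AB) => /(_ isT).
- by move: lt_AB; rewrite -eq_j eq_ji ltnn.
Qed.

Lemma extracted_wf R : extracted R -> wf_sky R.
Proof.
move=> exR; case: (posnP (size R)) => [/size0nil|R_gt0]; [by left|right].
move=> e; have : cell R (size R).-1 0 by apply: (ex_nonempty exR); rewrite prednK.
by rewrite /cell /row nth_last e.
Qed.

Lemma entry_ncols X r c : ncols X <= c -> entry X r c = 0.
Proof.
move=> le_c; rewrite /entry nth_default //; apply: leq_trans le_c.
case: (ltnP r (size X)) => [lt_r|le_r]; last by rewrite row_default.
by apply/leq_foldr_maxn/map_f; apply: mem_nth.
Qed.

(** Columns are compared from right to left, since [ex_least] refers to column [c.+1], and within a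
    column the rows are compared in order of extraction. *)
Lemma extracted_column_inj R S : extracted R -> extracted S ->
  (forall c, column R c =i column S c) -> R = S.
Proof.
move=> exR exS eRS.
apply: filling_ext; try exact: extracted_wf; try exact: ex_pos.
suff agree n c : maxn (ncols R) (ncols S) <= c + n ->
    forall r, entry R r c = entry S r c.
  move=> r c; exact: (agree (maxn (ncols R) (ncols S)) c (leq_addl _ _)).
elim: n c => [|n IHn] c.
  by rewrite addn0 geq_max => /andP [leR leS] r; rewrite !entry_ncols.
rewrite addnS -addSn => /IHn next; elim/ltn_ind => r IHr.
apply/eqP; rewrite eqn_leq; apply/andP; split; apply: extracted_step => //.
  by move=> x; rewrite eRS.
by move=> j lt_j; rewrite IHr.
Qed.

(** The final step of [psi], isolated so that it applies to any list of rows. *)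
Definition arrange (R : filling) : filling :=
  mkseq (fun i => head [::] [seq rw <- R | head 0 rw == i.+1])
        (foldr maxn 0 (map (head 0) R)).

Lemma row_arrange0 R r : row (arrange R) r = [::] \/
  exists2 j, j < size R & row (arrange R) r = row R j /\ entry R j 0 = r.+1.
Proof.
rewrite /arrange; set m := foldr _ _ _.
case: (ltnP r m) => [lt_r|le_r]; last by left; rewrite row_default // size_mkseq.
rewrite [row _ _]nth_mkseq //; case E: [seq _ <- _ | _] => [|rw s]; [by left|right].
have : rw \in [seq rw <- R | head 0 rw == r.+1] by rewrite E mem_head.
rewrite mem_filter => /andP [/eqP eq_h /(nthP [::]) [j lt_j eq_j]].
by exists j; rewrite // /entry nth0 /row eq_j.
Qed.

(** The heads form column 0 of [R] and are distinct, so row [j] is the only one with its head. *)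
Lemma row_arrange R j : extracted R -> j < size R ->
  row (arrange R) (entry R j 0).-1 = row R j.
Proof.
move=> exR lt_j; have cj := ex_nonempty exR lt_j.
have h_gt0 : 0 < entry R j 0 by rewrite entry_gt0 //; apply: ex_pos.
case: (row_arrange0 R (entry R j 0).-1) => [|[k lt_k [-> eq_k]]]; last first.
  congr row; apply: (ex_dist exR _ cj); first exact: (ex_nonempty exR).
  by rewrite eq_k prednK.
have j_in : row R j \in [seq rw <- R | head 0 rw == (entry R j 0).-1.+1].
  by rewrite mem_filter prednK // /entry nth0 eqxx mem_nth.
have lt_m : (entry R j 0).-1 < foldr maxn 0 (map (head 0) R).
  by rewrite prednK // leq_foldr_maxn // /entry nth0 map_f // mem_nth.
rewrite [row _ _]nth_mkseq //; case E: [seq _ <- _ | _] j_in => [//|rw s] _ /= rw0.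
(* An empty row in the filtered list would have head 0, not the positive head of row [j]. *)
have : rw \in [seq rw <- R | head 0 rw == (entry R j 0).-1.+1].
  by rewrite E mem_head.
by rewrite mem_filter rw0 prednK //= eq_sym (gtn_eqF h_gt0).
Qed.

Lemma cell_arrange R r c : cell (arrange R) r c -> exists2 j, j < size R &
  row (arrange R) r = row R j /\ entry R j 0 = r.+1.
Proof. by case: (row_arrange0 R r) => // e; rewrite /cell e. Qed.

Lemma column_arrange R c : extracted R -> column (arrange R) c =i column R c.
Proof.
move=> exR x; apply/columnP/columnP => -[r cr].
  case: (cell_arrange cr) => j lt_j [eq_j _] <-.
  by exists j; rewrite /cell /entry -eq_j.
move=> <-; exists (entry R r 0).-1; rewrite /cell /entry row_arrange //;
  exact: cell_size cr.
Qed.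

Lemma arrange_wf R : extracted R -> wf_sky (arrange R).
Proof.
move=> exR; set m := foldr maxn 0 (map (head 0) R).
case: (posnP m) => [m0|m_gt0]; first by left; rewrite /arrange -/m m0.
right; rewrite -nth_last size_mkseq -/m.
have /mapP [rw /(nthP [::]) [j lt_j eq_j] eq_m] := foldr_maxn_mem m_gt0.
have -> : m = entry R j 0 by rewrite /entry nth0 /row eq_j.
rewrite -/(row _ _) row_arrange // => e.
by have := ex_nonempty exR lt_j; rewrite /cell e.
Qed.

(** [ex_least] moves the comparison one column to the left at a time. In [arrange R] the conclusion
    says that row [i] lies below row [j]. *)
Lemma extracted_later R i j c : extracted R -> i < j -> cell R j c ->
  entry R i c < entry R j c -> entry R i 0 < entry R j 0.
Proof.
move=> exR lt_ij; elim: c => // c IH cj lt_c.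
have cj' := cell_le (leqnSn c) cj; apply: IH => //.
apply: (ex_least exR) => //; exact: leq_trans (ltnW lt_c) (ex_wd exR cj).
Qed.

Lemma qKT1_arrange R : extracted R -> qKT1 (arrange R).
Proof.
move=> exR; have [[pR wR] dR] := (ex_pos exR, ex_wd exR, ex_dist exR).
have headE r : cell (arrange R) r 0 -> entry (arrange R) r 0 = r.+1.
  by case/cell_arrange => j lt_j [eq_j <-]; rewrite /entry eq_j.
split=> //; split; first exact: arrange_wf.
split=> [r c cr|].
  have [j lt_j [eq_j e0]] := cell_arrange cr.
  move: cr; rewrite /cell /entry eq_j -e0 => cr.
  by rewrite pR //=; apply: entry_le.
split=> [r c cr|].
  have [j lt_j [eq_j e0]] := cell_arrange cr.
  by move: cr; rewrite /cell /entry eq_j => cr; apply: wR.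
split=> [r s c cr cs|].
  have [j lt_j [eq_j ej]] := cell_arrange cr.
  have [k lt_k [eq_k ek]] := cell_arrange cs.
  move: cr cs; rewrite /cell /entry eq_j eq_k => cr cs /(dR _ _ _ cr cs) eq_jk.
  by apply: succn_inj; rewrite -ej -ek eq_jk.
split=> [r s lt_rs cr cs|]; first by rewrite !headE // ltnS.
split=> r s c lt_rs.
  move=> cr cs; have [j lt_j [eq_j ej]] := cell_arrange cr.
  have [k lt_k [eq_k ek]] := cell_arrange cs.
  move: cr cs; rewrite /cell /entry eq_j eq_k => cr cs.
  rewrite -!/(entry R _ _) => lt_kj.
  (* Condition (3). If row [r] was extracted earlier, a failure would make its entry in column [c]
     the smaller one by leastness. If row [s] was, its smaller entry would put it below row [r]. *)
  have lt_k' : entry R k c < entry R j c.+1.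
    case: (ltngtP j k) => [lt_jk|lt_jk|eq_jk].
    - rewrite ltnNge; apply/negP => /(ex_least exR lt_jk cs); lia.
    - by have := extracted_later exR lt_jk cr lt_kj; rewrite ej ek; lia.
    - by move: lt_kj; rewrite eq_jk ltnn.
  by split=> //; rewrite -entry_gt0 // (leq_ltn_trans _ lt_k').
move=> lt_sz cr cs; have [j lt_j [eq_j ej]] := cell_arrange cr.
have [k lt_k [eq_k ek]] := cell_arrange cs.
move: lt_sz cr cs; rewrite /cell /entry eq_j eq_k => lt_sz cr cs.
(* Condition (4). The longer row [s] is extracted earlier, and a failure would put it below row
   [r]. *)
have lt_kj : k < j.
  case: (ltngtP j k) => // [lt_jk|eq_jk]; last by move: lt_sz; rewrite eq_jk ltnn.
  by have := ex_shape exR lt_jk lt_sz; rewrite /cell ltnn.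
rewrite -!/(entry R _ _) ltnNge; apply/negP => /(ex_least exR lt_kj cr) lt_c.
by have := extracted_later exR lt_kj cr lt_c; rewrite ej ek; lia.
Qed.

Lemma qKT1_extracted X : qKT1 X -> exists2 R, extracted R & arrange R = X.
Proof.
case=> -[wfX [bX [wX [dX [_ [k3 k4]]]]]] headE.
have pX : positive_entries X by move=> r c /bX /andP [].
pose a r := size (row X r).
pose before r s := (a s < a r) || ((a r == a s) && (r <= s)).
have before_total : total before by move=> r s; rewrite /before; lia.
have before_trans : transitive before by move=> s r t; rewrite /before; lia.
pose idx := sort before [seq r <- iota 0 (size X) | 0 < a r].
have idx_mem r : (r \in idx) = (0 < a r).
  rewrite mem_sort mem_filter mem_iota /= add0n andb_idr //.
  exact: cell_size.
have idx_uniq : uniq idx by rewrite sort_uniq filter_uniq ?iota_uniq.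
have idx_sorted : sorted before idx by apply: sort_sorted.
pose u i := nth 0 idx i.
pose R := [seq row X r | r <- idx].
have sizeR : size R = size idx by rewrite size_map.
have rowR i : i < size R -> row R i = row X (u i).
  by rewrite sizeR => lt_i; rewrite /row (nth_map 0).
have cellR i c : cell R i c -> i < size R /\ cell X (u i) c.
  by move=> ci; have lt_i := cell_size ci; rewrite /cell -rowR.
have entryR i c : i < size R -> entry R i c = entry X (u i) c.
  by move=> lt_i; rewrite /entry rowR.
have u_inj i j : i < size R -> j < size R -> u i = u j -> i = j.
  by rewrite sizeR => lt_i lt_j /eqP; rewrite nth_uniq // => /eqP.
have u_before i j : i < j -> j < size R ->
    a (u j) < a (u i) \/ (a (u i) = a (u j) /\ u i < u j).
  move=> lt_ij lt_j; have lt_i := ltn_trans lt_ij lt_j.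
  have : before (u i) (u j).
    apply: (sorted_leq_nth before_trans _ 0 idx_sorted); rewrite ?inE -?sizeR //.
      by move=> r; rewrite /before eqxx leqnn orbT.
    exact: ltnW.
  have : u i <> u j by move/(u_inj _ _ lt_i lt_j); lia.
  by rewrite /before; lia.
have exR : extracted R.
  split.
  - by move=> i c /cellR [lt_i ci]; rewrite entryR //; apply: pX.
  - by move=> i c /cellR [lt_i ci]; rewrite !entryR //; apply: wX.
  - move=> i j c /cellR [lt_i ci] /cellR [lt_j cj]; rewrite !entryR //.
    by move/(dX _ _ _ ci cj); apply: u_inj.
  - move=> i lt_i; rewrite /cell rowR // -/(a _) -idx_mem mem_nth //.
    by rewrite -sizeR.
  - move=> i j c lt_ij /cellR [lt_j cj]; rewrite /cell rowR ?(ltn_trans lt_ij) //.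
    by move: cj; rewrite /cell; case: (u_before _ _ lt_ij lt_j); rewrite /a; lia.
  - move=> i j c lt_ij /cellR [lt_j cj]; have lt_i := ltn_trans lt_ij lt_j.
    rewrite !entryR // => le_c.
    have ci : cell X (u i) c.
      by move: cj; rewrite /cell; case: (u_before _ _ lt_ij lt_j); rewrite /a; lia.
    (* If the earlier row is the lower one, condition (3) gives the inequality. If it is the higher
       one, it is strictly longer, and condition (4) contradicts [le_c]. *)
    case: (ltngtP (u i) (u j)) => [lt_u|lt_u|/(u_inj _ _ lt_i lt_j)]; last by lia.
      rewrite ltn_neqAle; apply/andP; split.
        by apply/eqP => /(dX _ _ _ ci cj); lia.
      by rewrite leqNgt; apply/negP => /(k3 _ _ _ lt_u ci cj) [_]; lia.
    have lt_a : a (u j) < a (u i) by case: (u_before _ _ lt_ij lt_j) => //; lia.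
    have ci' : cell X (u i) c.+1 by apply: leq_trans lt_a; rewrite ltnS.
    by have := k4 _ _ _ lt_u lt_a cj ci'; lia.
exists R => //.
have pA : positive_entries (arrange R).
  have [[_ [bA _]] _] := qKT1_arrange exR.
  by move=> r c /bA /andP [].
apply: filling_ext => //; first exact: arrange_wf.
suff eq_row r : row (arrange R) r = row X r by move=> r c; rewrite /entry eq_row.
case: (posnP (a r)) => [a0|a_gt0].
  rewrite (size0nil a0); case: (row_arrange0 R r) => // -[j lt_j [-> ej]].
  rewrite rowR //; have cj := ex_nonempty exR lt_j.
  move: ej; rewrite entryR // headE; last by case/cellR: cj.
  by case=> ->; apply: size0nil.
have [j lt_j eq_j] : exists2 j, j < size R & u j = r.
  by exists (index r idx); rewrite /u ?nth_index ?sizeR ?index_mem ?idx_mem.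
have cj : cell X (u j) 0 by rewrite /cell eq_j.
by have := row_arrange exR lt_j; rewrite entryR // headE // rowR // eq_j.
Qed.

(** The invariant of row extraction. [cf_dom] is the counting form of the fact that the columns can
    be arranged into weakly decreasing rows. *)
Record column_flag (cs : seq (seq nat)) : Prop := ColumnFlag {
  cf_pos : forall c x, x \in nth [::] cs c -> 0 < x;
  cf_uniq : forall c, uniq (nth [::] cs c);
  cf_dom : forall c x,
    count (leq x) (nth [::] cs c.+1) <= count (leq x) (nth [::] cs c)
}.

Lemma column_flag_cols V : revSSYT V -> column_flag (cols V).
Proof.
move=> revV; have [_ [_ [pV [wV _]]]] := revV.
split=> [c x|c|c x]; rewrite !nth_cols.
- by case/columnP => r /pV + <-.
- exact/column_uniq/revSSYT_col_distinct.
- exact: count_column.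
Qed.

(** At threshold 0, dominance compares the sizes of the columns. *)
Lemma flag_nil cs c c' : column_flag cs -> c <= c' ->
  nth [::] cs c = [::] -> nth [::] cs c' = [::].
Proof.
move=> flag; elim: c' => [|c' IH]; first by rewrite leqn0 => /eqP ->.
rewrite leq_eqVlt => /predU1P [<- //|/IH nil_c /nil_c e].
have := cf_dom flag c' 0; rewrite e /= leqn0 (eq_count (a2 := predT)) //.
by rewrite count_predT => /eqP/size0nil.
Qed.

(** * Trimming the columns and choosing a chain *)

Lemma trim_rcons cs C :
  trim (rcons cs C) = if C == [::] then trim cs else rcons cs C.
Proof. by rewrite /trim rev_rcons /=; case: ifP => //; rewrite rev_cons revK. Qed.

Lemma nth_trim cs c : nth [::] (trim cs) c = nth [::] cs c.
Proof.
elim/last_ind: cs => // cs C IH; rewrite trim_rcons; case: eqP => // ->.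
by rewrite IH nth_rcons; case: ltngtP => // le_c; rewrite nth_default // -?le_c // ltnW.
Qed.

Lemma last_trim cs : trim cs <> [::] -> last [::] (trim cs) <> [::].
Proof.
elim/last_ind: cs => // cs C IH; rewrite trim_rcons; case: eqP => // C_ne _.
by rewrite last_rcons.
Qed.

Lemma column_flag_trim cs : column_flag cs -> column_flag (trim cs).
Proof. by case=> pos unq dom; split=> [c x|c|c x]; rewrite !nth_trim //; apply: pos. Qed.

Lemma nth_trim_neq0 cs c : column_flag cs -> c < size (trim cs) ->
  nth [::] (trim cs) c <> [::].
Proof.
move=> flag lt_c nil_c; have flag' := column_flag_trim flag.
have ne : trim cs <> [::] by move=> e; rewrite e in lt_c.
apply: (last_trim ne); rewrite -nth_last; apply: flag_nil flag' _ nil_c.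
by case: (size _) lt_c.
Qed.

Lemma least_geqP b C : has (leq b) C ->
  [/\ least_geq b C \in C, b <= least_geq b C &
      {in C, forall z, b <= z -> least_geq b C <= z}].
Proof.
move=> hasC; rewrite /least_geq; set s := sort _ _.
have s_mem z : (z \in s) = (b <= z) && (z \in C) by rewrite mem_sort mem_filter.
have srt : sorted leq s by apply: sort_sorted; apply: leq_total.
case: s s_mem srt => [|y s] s_mem srt /=.
  by case/hasP: hasC => z zC le_z; have := s_mem z; rewrite le_z zC.
have /andP [le_y yC] : (b <= y) && (y \in C) by rewrite -s_mem mem_head.
split=> // z zC le_z; have : z \in y :: s by rewrite s_mem le_z.
rewrite in_cons => /predU1P [-> //|z_s].
exact: (allP (order_path_min leq_trans srt)).
Qed.

(** The output of [chain] indexed from the leftmost column, which [psi] obtains by reversing twice.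
    Past the last column it reads 0, so there the least element is taken. *)
Fixpoint chain_up (cs : seq (seq nat)) : seq nat :=
  if cs is C :: cs' then
    let ys := chain_up cs' in least_geq (head 0 ys) C :: ys
  else [::].

Lemma chain_rcons b s C :
  chain b (rcons s C) = rcons (chain b s) (least_geq (last b (chain b s)) C).
Proof. by elim: s b => //= D s IH b; rewrite IH. Qed.

Lemma rev_chain cs : rev (chain 0 (rev cs)) = chain_up cs.
Proof.
elim: cs => //= C cs <-; rewrite rev_cons chain_rcons rev_rcons.
by congr (least_geq _ _ :: _); case/lastP: (chain _ _) => // s x; rewrite last_rcons rev_rcons.
Qed.

Lemma size_chain_up cs : size (chain_up cs) = size cs.
Proof. by elim: cs => //= C cs ->. Qed.

Lemma nth_chain_up cs c : c < size cs ->
  nth 0 (chain_up cs) c = least_geq (nth 0 (chain_up cs) c.+1) (nth [::] cs c).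
Proof. by elim: cs c => //= C cs IH [|c] /= lt_c; [rewrite nth0|apply: IH]. Qed.

(** The chain entry of column [c.+1] makes the count at that threshold positive, and dominance
    passes this on to column [c]. In the last column the threshold is 0 and any element will do. *)
Lemma has_chain_up cs c :
    column_flag cs -> (forall c, c < size cs -> nth [::] cs c <> [::]) ->
  c < size cs -> has (leq (nth 0 (chain_up cs) c.+1)) (nth [::] cs c).
Proof.
elim: cs c => // C cs IH c flag ne lt_c.
have flag' : column_flag cs.
  by case: flag => pos unq dom; split=> d; [apply: (pos d.+1)|apply: (unq d.+1)|apply: (dom d.+1)].
have ne' d : d < size cs -> nth [::] cs d <> [::] by move=> /(ne d.+1).
case: c lt_c => [_|c lt_c]; last exact: IH.
case: (posnP (size cs)) => [/size0nil ->|cs_gt0].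
  by move: (ne 0 isT) => /=; case: C {ne flag IH}.
have [y_in _ _] := least_geqP (IH 0 flag' ne' cs_gt0).
rewrite has_count /= (leq_trans _ (cf_dom flag 0 _)) // -has_count.
apply/hasP; exists (nth 0 (chain_up cs) 0); last exact: leqnn.
by rewrite /= nth_chain_up.
Qed.

Lemma count_leq_gt (C : seq nat) x y : y \in C -> y < x ->
  count (leq x) C < count (leq y) C.
Proof.
move=> yC lt_yx; have /permP eqC := perm_to_rem yC.
rewrite !eqC /= leqnn [x <= y]leqNgt lt_yx add0n add1n ltnS.
by apply: sub_count => z /=; apply: leq_trans (ltnW lt_yx).
Qed.

(** * Deleting one chain from the columns *)

Section RemoveChain.

Variable cs : seq (seq nat).
Hypothesis flag : column_flag cs.
Hypothesis cs_ne : forall c, c < size cs -> nth [::] cs c <> [::].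

Let y c := nth 0 (chain_up cs) c.

Lemma chain_upP c : c < size cs ->
  [/\ y c \in nth [::] cs c, y c.+1 <= y c &
      {in nth [::] cs c, forall z, y c.+1 <= z -> y c <= z}].
Proof.
by move=> lt_c; rewrite /y (nth_chain_up lt_c); apply/least_geqP/has_chain_up.
Qed.

Definition remove_chain := [seq rem p.1 p.2 | p <- zip (chain_up cs) cs].

Lemma nth_remove_chain c :
  nth [::] remove_chain c = rem (y c) (nth [::] cs c).
Proof.
have sz : size (zip (chain_up cs) cs) = size cs.
  by rewrite size_zip size_chain_up minnn.
case: (ltnP c (size cs)) => [lt_c|le_c].
  by rewrite (nth_map (0, [::])) ?sz // nth_zip ?size_chain_up.
by rewrite !nth_default // size_map sz.
Qed.

(** For [x <= y c.+1] both counts drop by one, and for [x > y c] neither does. In between only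
    column [c] loses an entry, and there dominance was strict. *)
Lemma column_flag_remove_chain : column_flag remove_chain.
Proof.
split=> [c x|c|c x]; rewrite !nth_remove_chain.
- by move/mem_rem; apply: cf_pos.
- by rewrite rem_uniq // cf_uniq.
case: (ltnP c.+1 (size cs)) => [lt_c|le_c]; last first.
  by rewrite (nth_default [::] le_c).
have [in_c le_y least_y] := chain_upP (ltnW lt_c).
have [in_c1 _ _] := chain_upP lt_c.
rewrite !count_rem in_c in_c1 /=; have dom := cf_dom flag c.
case: (leqP x (y c.+1)) => [le_x|lt_x].
  by rewrite (leq_trans le_x le_y); apply: leq_sub2r.
rewrite subn0; case: (leqP x (y c)) => [le_x|_]; last by rewrite subn0.
(* By the choice of [y c], no entry of column [c] lies from [y c.+1] up to [x]. Column [c.+1] does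
   have one, namely [y c.+1], hence the strictness. *)
have eq_cnt : count (leq x) (nth [::] cs c) = count (leq (y c.+1)) (nth [::] cs c).
  apply: eq_in_count => z z_c; apply/idP/idP => [|le_z].
    exact: leq_trans (ltnW lt_x).
  exact: leq_trans (least_y z z_c le_z).
by have := dom (y c.+1); have := count_leq_gt in_c1 lt_x; rewrite eq_cnt /=; lia.
Qed.

(** The choice of the chain is [ex_least] for the new first row. Strictness holds because columns
    have no repetitions, so the later rows avoid the chain entries. *)
Lemma extracted_cons R : 0 < size cs -> extracted R ->
    (forall c, column R c =i nth [::] remove_chain c) ->
  extracted (chain_up cs :: R) /\
  forall c, column (chain_up cs :: R) c =i nth [::] cs c.
Proof.
move=> cs_gt0 exR colR.
have inR r c : cell R r c -> [/\ c < size cs, entry R r c != y c & entry R r c \in nth [::] cs c].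
  move=> cr; have : entry R r c \in nth [::] remove_chain c.
    by rewrite -colR; apply/columnP; exists r.
  rewrite nth_remove_chain mem_rem_uniq ?cf_uniq // inE => /andP [ne in_c].
  by split=> //; rewrite ltnNge; apply/negP => le_c; rewrite nth_default in in_c.
have c0 c : cell (chain_up cs :: R) 0 c -> c < size cs by rewrite /cell /= size_chain_up.
split; last first.
  move=> c x; rewrite /column /= size_chain_up; case: (ltnP c (size cs)) => [lt_c|le_c].
    rewrite /= in_cons -/(column R c) colR nth_remove_chain mem_rem_uniq ?cf_uniq // inE.
    by case: eqP => // ->; have [->] := chain_upP lt_c.
  by rewrite -/(column R c) colR nth_remove_chain !(nth_default [::] le_c).
split.
- move=> [|r] c cr; last exact: (ex_pos exR).
  by have [in_c _ _] := chain_upP (c0 _ cr); apply: cf_pos in_c.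
- move=> [|r] c cr; last exact: (ex_wd exR).
  by have [_ le_c _] := chain_upP (ltnW (c0 _ cr)).
- move=> [|r] [|s] c cr cs' //.
  + by move=> e; have [_ /eqP ne _] := inR _ _ cs'; case: ne.
  + by move=> e; have [_ /eqP ne _] := inR _ _ cr; case: ne.
  + by move/(ex_dist exR cr cs') ->.
- by move=> [_|r]; [rewrite /cell /= size_chain_up|apply: (ex_nonempty exR)].
- move=> [|i] [|j] c //= lt_ij cj; last exact: (@ex_shape _ exR i j).
  by have [lt_c _ _] := inR _ _ cj; rewrite /cell /= size_chain_up.
- move=> [|i] [|j] c //= lt_ij cj; last exact: (@ex_least _ exR i j).
  have [lt_c ne in_c] := inR _ _ cj; have [_ _ least_c] := chain_upP lt_c.
  move=> le_c; rewrite ltn_neqAle eq_sym ne; exact: least_c.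
Qed.

End RemoveChain.

(** Each extraction shortens the first column by one, so its size is enough fuel. *)
Lemma psi_rowsP n cs : column_flag cs -> size (nth [::] cs 0) <= n ->
  extracted (psi_rows n cs) /\ forall c, column (psi_rows n cs) c =i nth [::] cs c.
Proof.
have done cs' : column_flag cs' -> nth [::] cs' 0 = [::] ->
    extracted [::] /\ forall c, column [::] c =i nth [::] cs' c.
  move=> flag nil0; split; last by move=> c; rewrite (flag_nil flag (leq0n c) nil0).
  have no r c : cell [::] r c -> False by rewrite /cell /row nth_nil.
  by split=> // r; [move=> c /no|move=> c /no|move=> s c /no|move=> s c _ /no|move=> s c _ /no].
elim: n cs => [|n IH] cs flag; first by rewrite leqn0 => /eqP/size0nil; apply: done.
move=> le_n /=; have flag' := column_flag_trim flag.
have ne := @nth_trim_neq0 cs ^~ flag.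
case E: (trim cs) => [|C cs']; first by apply: done; rewrite // -nth_trim E.
rewrite -E rev_chain.
have gt0 : 0 < size (trim cs) by rewrite E.
have [exR colR] : extracted (psi_rows n (remove_chain (trim cs))) /\
    forall c, column (psi_rows n (remove_chain (trim cs))) c =i nth [::] (remove_chain (trim cs)) c.
  apply: IH; first exact: column_flag_remove_chain.
  have [in_0 _ _] := chain_upP flag' ne gt0.
  by rewrite nth_remove_chain size_rem // nth_trim -subn1 leq_subLR add1n.
have [exR' colR'] := extracted_cons flag' ne gt0 exR colR.
by split=> // c x; rewrite colR' nth_trim.
Qed.

Lemma psi_qKT1 V : revSSYT V ->
  qKT1 (psi V) /\ forall c, column (psi V) c =i column V c.
Proof.
move=> revV; have flag := column_flag_cols revV.
case: (@psi_rowsP (size (flatten V)) _ flag) => [|exR colR].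
  (* A nonempty row contributes one entry to column 0 and at least one to [flatten V]. *)
  rewrite nth_cols /column size_map size_filter size_flatten.
  by elim: V {revV flag} => //= -[|x rw] V IH //=; rewrite add1n addSn ltnS (leq_trans IH) ?leq_addl.
split; first exact: qKT1_arrange.
by move=> c x; rewrite [LHS]column_arrange // colR nth_cols.
Qed.

Lemma qKT1_column_inj X Y : qKT1 X -> qKT1 Y ->
  (forall c, column X c =i column Y c) -> X = Y.
Proof.
move=> /qKT1_extracted [R exR <-] /qKT1_extracted [S exS <-] eqRS.
congr arrange; apply: extracted_column_inj => // c x.
by rewrite -(column_arrange c exR) eqRS column_arrange.
Qed.

Theorem theorem5p12 :
  bij_between QrevSSYT QqKT1 psi /\ bij_between QrevSSYT QSSF Gamma.
Proof.
split; apply: bij_between_quasiYam.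
- exact: psi_qKT1.
- move=> X [[_ [bX [wX [dX _]]]] _]; split=> // r c /bX /andP [].
  by [].
- exact: qKT1_column_inj.
- exact: Gamma_ASSF.
- by move=> X [_ [pX [wX [dX _]]]].
- exact: ASSF_column_inj.
Qed.
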